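(* Suppose $n\ge 1$ is fixed. Then there is an algorithm in the BSS model over $\mathbb{R}$, running in time polynomial in the input size, that for any input $r\in\mathbb{R}^n$ and any input $n$-variate exponential $t$-sum $g$ (with $t\ge 2$) outputs the closure, described as an explicit intersection of $O(t^2)$ half-spaces, of the unique cell $\sigma_r$ of $\Sigma(\mathrm{Trop}(g))$ whose relative interior contains $r$.
   Context: An $n$-variate exponential $t$-sum is a function $g(z)=\sum_{j=1}^t e^{a_j\cdot z+\beta_j}$ on $\mathbb{C}^n$ with pairwise distinct $a_j\in\mathbb{R}^n$ and $\beta_j\in\mathbb{C}$, where $a_j\cdot z=\sum_i a_{j,i}z_i$; it is given as input by its $a_j$ and $\beta_j$. For $t\ge2$, its tropical variety is $\mathrm{Trop}(g):=\{(\mathrm{Re}(z_1),\ldots,\mathrm{Re}(z_n)) : z\in\mathbb{C}^n,\ \max_j|e^{a_j\cdot z+\beta_j}|\text{ is attained at at least two distinct } j\}\subset\mathbb{R}^n$. $\Sigma(\mathrm{Trop}(g))$ denotes the polyhedral complex whose cells are exactly the (possibly improper) faces of the closures of the connected components of $\mathbb{R}^n\setminus\mathrm{Trop}(g)$. The BSS (Blum-Shub-Smale) model over $\mathbb{R}$ augments the classical Turing machine by allowing exact field operations and comparisons over $\mathbb{R}$ in unit time. The input size of a point in $\mathbb{R}^n$ is defined to be $n$, and that of an $n$-variate exponential $t$-sum is defined to be $(n+1)t$. *)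

(* Defs.v *)
From HB Require Import structures.
From mathcomp Require Import all_boot all_order all_algebra.
From mathcomp Require Import all_classical all_reals all_analysis.
From mathcomp Require Import complex.

Set Implicit Arguments.
Unset Strict Implicit.
Unset Printing Implicit Defensive.

Import Order.TTheory GRing.Theory Num.Theory.
Import numFieldNormedType.Exports.

Local Open Scope classical_set_scope.
Local Open Scope ring_scope.
Local Open Scope complex_scope.

Section BSS.
Variable R : realType.

(* A BSS machine over R in the uniform (Blum-Cucker-Shub-Smale) setting: a
   finite flowchart acting on a two-way infinite tape of reals.  The tape is
   addressed relative to the head, which sits at address 0, so an instruction
   only reaches a bounded window around the head.  The flowchart is a list of
   instructions; a node is a position in that list. *)
Inductive instr :=
| Const of int & R              (* x_k := c *)
| Copy of int & int             (* x_k := x_i *)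
| Add of int & int & int        (* x_k := x_i + x_j *)
| Sub of int & int & int        (* x_k := x_i - x_j *)
| Mul of int & int & int        (* x_k := x_i * x_j *)
| Div of int & int & int        (* x_k := x_i / x_j, stuck if x_j = 0 *)
| Branch of int & int & nat     (* if x_i <= x_j then goto the given node *)
| MoveL
| MoveR
| Halt.

Definition machine := seq instr.

Definition tape := int -> R.

Definition config := (nat * tape)%type.

Definition upd (x : tape) (k : int) (c : R) : tape :=
  fun i => if i == k then c else x i.

Definition cur_instr (M : machine) (s : config) : instr := nth Halt M s.1.

(* [None] means that there is no successor: the machine has halted, or it has
   attempted a division by zero. *)
Definition step (M : machine) (s : config) : option config :=
  let: (q, x) := s in
  match cur_instr M s with
  | Const k c => Some (q.+1, upd x k c)
  | Copy k i => Some (q.+1, upd x k (x i))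
  | Add k i j => Some (q.+1, upd x k (x i + x j))
  | Sub k i j => Some (q.+1, upd x k (x i - x j))
  | Mul k i j => Some (q.+1, upd x k (x i * x j))
  | Div k i j => if x j == 0 then None else Some (q.+1, upd x k (x i / x j))
  | Branch i j l => Some (if x i <= x j then l else q.+1, x)
  | MoveL => Some (q.+1, fun i => x (i - 1))
  | MoveR => Some (q.+1, fun i => x (i + 1))
  | Halt => None
  end.

(* The tape on which M halts when started from s, if it reaches a halting node
   in at most T steps. *)
Fixpoint exec (M : machine) (T : nat) (s : config) : option tape :=
  if cur_instr M s is Halt then Some s.2
  else if T is T'.+1 then obind (exec M T') (step M s) else None.

(* A point w of R^oo (the disjoint union of the R^k) is presented to the machine
   with its length in front: |w|, w_0, w_1, ... starting at the head, all other
   cells being 0. *)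
Definition load (w : seq R) : tape := fun i =>
  match i with
  | Posz 0 => (size w)%:R
  | Posz k.+1 => w`_k
  | Negz _ => 0
  end.

(* The output is read in the same format, the remaining cells being ignored. *)
Definition reads (x : tape) (w : seq R) : Prop :=
  x 0 = (size w)%:R /\ forall k : nat, (k < size w)%N -> x k.+1%:Z = w`_k.

Definition outputs_within (M : machine) (w : seq R) (T : nat) (w' : seq R) :
    Prop :=
  exists2 x : tape, exec M T (0%N, load w) = Some x & reads x w'.

End BSS.

Section Polyhedra.
Variables (R : realType) (n : nat).
Implicit Types (P F S : set 'rV[R]_n) (x y : 'rV[R]_n).

Definition dotv x y : R := \sum_i x 0 i * y 0 i.

(* (c, d) stands for { x | c . x <= d }. *)
Definition halfspace (h : 'rV[R]_n * R) : set 'rV[R]_n :=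
  [set x | dotv h.1 x <= h.2].

(* c = 0 is allowed, so that P itself and the empty set are (improper) faces. *)
Definition face P F : Prop :=
  exists (c : 'rV[R]_n) (d : R),
    P `<=` halfspace (c, d) /\ F = P `&` [set x | dotv c x = d].

Definition affine_hull S : set 'rV[R]_n :=
  [set y | exists (k : nat) (p : 'I_k -> 'rV[R]_n) (w : 'I_k -> R),
     [/\ forall i, S (p i), \sum_i w i = 1 & y = \sum_i w i *: p i]].

Definition relint S : set 'rV[R]_n :=
  [set x | S x /\ within (affine_hull S) (nbhs x) S].

End Polyhedra.

Section ExponentialSums.
Variable R : realType.

Definition expC (z : R[i]) : R[i] :=
  (expR (complex.Re z))%:C * (cos (complex.Im z) +i* sin (complex.Im z)).

Record expsum (n t : nat) := ExpSum {
  freq : 'I_t -> 'rV[R]_n;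
  offset : 'I_t -> R[i];
  freq_inj : injective freq
}.

Variables n t : nat.
Implicit Type g : expsum n t.

Definition expterm g (j : 'I_t) (z : 'rV[R[i]]_n) : R[i] :=
  expC (\sum_i (freq g j 0 i)%:C * z 0 i + offset g j).

Definition expsum_fun g (z : 'rV[R[i]]_n) : R[i] := \sum_j expterm g j z.

Definition Trop g : set 'rV[R]_n :=
  [set map_mx (@complex.Re R) z | z in
    [set z : 'rV[R[i]]_n | exists j k : 'I_t,
       [/\ j != k,
           forall l, `|expterm g l z| <= `|expterm g j z| &
           forall l, `|expterm g l z| <= `|expterm g k z|]]].

Definition Sigma_Trop g : set (set 'rV[R]_n) :=
  [set F | exists2 x, (~` Trop g) x &
             face (closure (connected_component (~` Trop g) x)) F].

End ExponentialSums.

Section Encodings.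
Variables (R : realType) (n : nat).

Definition coords (x : 'rV[R]_n) : seq R := [seq x 0 i | i <- enum 'I_n].

(* r, followed by a_j, Re(beta_j), Im(beta_j) for each j. *)
Definition encode_input (t : nat) (r : 'rV[R]_n) (g : expsum R n t) : seq R :=
  coords r ++
  flatten [seq coords (freq g j) ++
             [:: complex.Re (offset g j); complex.Im (offset g j)]
          | j <- enum 'I_t].

Definition encode_halfspaces (hs : seq ('rV[R]_n * R)) : seq R :=
  flatten [seq rcons (coords h.1) h.2 | h <- hs].

End Encodings.

(* Size n for the point, (n+1)t for the exponential sum. *)
Definition input_size (n t : nat) : nat := (n + n.+1 * t)%N.

(* Main.v *)
Require Import Defs.
From HB Require Import structures.
From mathcomp Require Import all_boot all_order all_algebra.
From mathcomp Require Import all_classical all_reals all_analysis.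
From mathcomp Require Import complex.
From mathcomp Require Import zify ring lra.

(** Write l_j(x) = a_j.x + Re(beta_j) for the logarithm of the modulus of the
    j-th term above x.  The tropical variety is the set of ties for the maximum
    of the l_j, and the components of its complement are the open polyhedra on
    which one fixed l_j is the strict maximum ([Trop_tie], [component_region]).
    The closure of such a component is the polyhedron where l_j is maximal
    ([closure_region]), and the face of it containing r in its relative interior
    is cut out by the inequalities that are equalities at r; so it is the set
      sigma r = { x | every term dominating at r dominates at x },
    whichever dominating j one starts from ([sigma_face], [relint_sigma],
    [face_sigma]).  A dominating j whose polyhedron has nonempty interior exists:
    among the dominating terms take the one with the longest frequency vector,
    and move from r in the direction of that vector ([region_near]).

    For the algorithm any dominating term J will do, even one whose polyhedron is
    degenerate: sigma r is described by the half-spaces l_k <= l_J for k <> J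
    and by the reverse ones for the k that tie with J at r ([sigma_output]).
    The program computes the values l_k(r), keeps the best term J, and then
    writes two half-spaces for each k <> J, behind the input ([runs_program]).

    A machine instruction only reaches a window around the head, whereas the
    input is unbounded.  A block of twelve registers is therefore carried along
    with the head: moving it one cell to the right is the same as moving one
    memory cell from its right to its left.  With the position stored in a
    register this gives access to memory at computed addresses ([runs_fetch],
    [runs_emit]).  Programs are written with structured commands
    whose loops all iterate at most B times, B being linear in the input size; the
    running time is then bounded by a polynomial in B read off from the text of
    the program ([cost]). *)

Set Implicit Arguments.
Unset Strict Implicit.
Unset Printing Implicit Defensive.

Import Order.TTheory GRing.Theory Num.Theory.
Import numFieldNormedType.Exports.

Local Open Scope classical_set_scope.
Local Open Scope ring_scope.

Arguments Copy {R} _ _.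
Arguments Add {R} _ _ _.
Arguments Defs.Sub {R} _ _ _.
Arguments Mul {R} _ _ _.
Arguments Branch {R} _ _ _.
Arguments MoveL {R}.
Arguments MoveR {R}.
Arguments Halt {R}.

(** * Structured programs for the flowchart machine *)

Section Structured.
Variable R : realType.
Implicit Types (z : seq R * seq R) (M : machine R).

Inductive cmd :=
| Skip
| Op of instr R
| Seq of cmd & cmd
| Unless of nat & nat & cmd    (* skip the command if x_i <= x_j *)
| Until of nat & nat & cmd.    (* repeat the command until x_i <= x_j *)

Fixpoint clen (c : cmd) : nat :=
  match c with
  | Skip => 0
  | Op _ => 1
  | Seq c1 c2 => clen c1 + clen c2
  | Unless _ _ c => (clen c).+1
  | Until _ _ c => (clen c).+2
  end.

Fixpoint compile (o : nat) (c : cmd) : seq (instr R) :=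
  match c with
  | Skip => [::]
  | Op a => [:: a]
  | Seq c1 c2 => compile o c1 ++ compile (o + clen c1) c2
  | Unless i j c => Branch i j (o.+1 + clen c) :: compile o.+1 c
  | Until i j c =>
      Branch i j (o.+2 + clen c) :: rcons (compile o.+1 c) (Branch 0 0 o)
  end.

(** The running time as a polynomial in a bound on the number of iterations of
    every loop; it depends on the program alone. *)
Fixpoint cost (c : cmd) : {poly nat} :=
  match c with
  | Skip => 0
  | Op _ => 1
  | Seq c1 c2 => cost c1 + cost c2
  | Unless _ _ c => 1 + cost c
  | Until _ _ c => 'X * (cost c + 2%:P) + 1
  end.

Lemma size_compile o c : size (compile o c) = clen c.
Proof.
elim: c o => //= [c1 IH1 c2 IH2|i j c IH|i j c IH] o.
- by rewrite size_cat IH1 IH2.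
- by rewrite IH.
- by rewrite size_rcons IH.
Qed.

(** A zipper: the first list holds the cells to the left of the head, nearest
    first, the second those from address 0 on, and all others are 0. *)
Definition tape_of z : tape R :=
  fun i => match i with Posz k => z.2`_k | Negz k => z.1`_k end.

Lemma load_tape_of (w : seq R) : load w = tape_of ([::], (size w)%:R :: w).
Proof.
by apply/funext => -[[|k]|k] //=; rewrite nth_nil.
Qed.

Lemma exec_halt M T q x : nth Halt M q = Halt -> exec M T (q, x) = Some x.
Proof. by case: T => [|T] /=; rewrite /cur_instr /= => ->. Qed.

Lemma exec_step M T s s' : step M s = Some s' -> exec M T.+1 s = exec M T s'.
Proof.
case: s => q x; rewrite /= /cur_instr /=.
by case: (nth Halt M q) => //= *; match goal with H : _ = Some _ |- _ =>
  move: H; (case=> <- // || move=> -> //) end.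
Qed.

Lemma exec_mono M T T' s x :
  (T <= T')%N -> exec M T s = Some x -> exec M T' s = Some x.
Proof.
elim: T T' s => [|T IH] [|T'] s //=; case: (cur_instr M s) => //= *;
  match goal with H : obind _ ?u = Some _ |- _ =>
    move: H; case: u => //= s'; exact: IH end.
Qed.

Variable B : nat.

Lemma cost_op a : (cost (Op a)).[B] = 1%N.
Proof. exact: hornerC. Qed.

Lemma cost_seq c1 c2 :
  (cost (Seq c1 c2)).[B] = ((cost c1).[B] + (cost c2).[B])%N.
Proof. exact: hornerD. Qed.

Lemma cost_unless i j c : (cost (Unless i j c)).[B] = (cost c).[B].+1.
Proof. by rewrite /= hornerD hornerC. Qed.

Lemma cost_until i j c :
  (cost (Until i j c)).[B] = (B * ((cost c).[B] + 2) + 1)%N.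
Proof. by rewrite /= hornerD hornerM hornerX hornerD !hornerC. Qed.

(** The continuation form makes sequencing immediate: whatever the machine
    computes from the end of the code, it also computes from its beginning. *)
Definition runs (c : cmd) z z' := forall pre post k x,
  exec (pre ++ compile (size pre) c ++ post) k
    ((size pre + clen c)%N, tape_of z') = Some x ->
  exec (pre ++ compile (size pre) c ++ post) ((cost c).[B] + k)
    (size pre, tape_of z) = Some x.

Lemma runs_skip z : runs Skip z z.
Proof. by move=> pre post k x /=; rewrite addn0 horner0. Qed.

Lemma runs_seq c1 c2 z1 z2 z3 :
  runs c1 z1 z2 -> runs c2 z2 z3 -> runs (Seq c1 c2) z1 z3.
Proof.
move=> H1 H2 pre post k x; rewrite cost_seq /= -addnA -catA => H.
apply: H1; have := H2 (pre ++ compile (size pre) c1) post k x.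
by rewrite /= !size_cat !size_compile -!catA; apply; rewrite -addnA.
Qed.

Lemma nth_code (pre post : machine R) a : nth Halt (pre ++ a :: post) (size pre) = a.
Proof. by rewrite nth_cat ltnn subnn. Qed.

Lemma step_branch_taken M q (i j : nat) l z :
  nth Halt M q = Branch i j l -> z.2`_i <= z.2`_j ->
  step M (q, tape_of z) = Some (l, tape_of z).
Proof. by rewrite /= /cur_instr /= => -> ->. Qed.

Lemma step_branch_next M q (i j : nat) l z :
  nth Halt M q = Branch i j l -> z.2`_j < z.2`_i ->
  step M (q, tape_of z) = Some (q.+1, tape_of z).
Proof. by rewrite /= /cur_instr /= ltNge => -> /negPf ->. Qed.

Lemma runs_unless_skip i j c z : z.2`_i <= z.2`_j -> runs (Unless i j c) z z.
Proof.
move=> le_ij pre post k x; rewrite cost_unless [compile _ _]/= [clen _]/= => H.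
rewrite addSn (exec_step _ (step_branch_taken (nth_code _ _ _) le_ij)).
by apply: (exec_mono (leq_addl _ k)); rewrite addnS in H.
Qed.

Lemma runs_unless i j c z z' :
  z.2`_j < z.2`_i -> runs c z z' -> runs (Unless i j c) z z'.
Proof.
move=> lt_ji H pre post k x; rewrite cost_unless [compile _ _]/= [clen _]/= => Hk.
rewrite addSn (exec_step _ (step_branch_next (nth_code _ _ _) lt_ji)).
have := H (rcons pre (Branch i j ((size pre).+1 + clen c))) post k x.
rewrite size_rcons !cat_rcons => ->//.
by move: Hk; rewrite [clen (Unless _ _ _)]/= addnS.
Qed.

(** The loop makes m iterations, of which [cost] charges B. *)
Lemma runs_until i j c (m : nat) (z : nat -> seq R * seq R) :
  (m <= B)%N ->
  (forall k, (k < m)%N -> (z k).2`_j < (z k).2`_i /\ runs c (z k) (z k.+1)) ->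
  (z m).2`_i <= (z m).2`_j ->
  runs (Until i j c) (z 0%N) (z m).
Proof.
move=> mB Hstep Hend pre post k x; rewrite cost_until.
pose br : instr R := Branch i j ((size pre).+2 + clen c).
pose M := pre ++ br :: compile (size pre).+1 c ++ Branch 0 0 (size pre) :: post.
have -> : pre ++ compile (size pre) (Until i j c) ++ post = M.
  by rewrite /M /= cat_rcons.
have MB : nth Halt M (size pre) = br by exact: nth_code.
have Mback : nth Halt M ((size pre).+1 + clen c) = Branch 0 0 (size pre).
  rewrite /M -cat_rcons catA.
  by rewrite -(size_compile (size pre).+1 c) -(size_rcons pre br) -size_cat nth_code.
have -> : (size pre + clen (Until i j c) = (size pre).+2 + clen c)%N.
  by rewrite /= !addnS.
move=> Hk.
have body d k' : (d < m)%N ->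
    exec M k' (((size pre).+1 + clen c)%N, tape_of (z d.+1)) = Some x ->
    exec M ((cost c).[B] + k') ((size pre).+1, tape_of (z d)) = Some x.
  move=> /Hstep[_ /(_ (rcons pre br) (Branch 0 0 (size pre) :: post) k' x)].
  by rewrite size_rcons !cat_rcons.
(* induction on the number d of iterations that remain *)
have main d : (d <= m)%N ->
    exec M (d * ((cost c).[B] + 2) + 1 + k) (size pre, tape_of (z (m - d)%N))
      = Some x.
  elim: d => [_|d IH lt_dm].
    by rewrite subn0 mul0n add0n add1n (exec_step _ (step_branch_taken MB Hend)).
  have [lt_ji _] := Hstep (m - d.+1)%N ltac:(lia).
  have -> : (d.+1 * ((cost c).[B] + 2) + 1 + k =
    ((cost c).[B] + (d * ((cost c).[B] + 2) + 1 + k).+1).+1)%N by lia.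
  rewrite (exec_step _ (step_branch_next MB lt_ji)).
  apply: body; first lia.
  rewrite (exec_step _ (step_branch_taken Mback (lexx _))).
  have -> : (m - d.+1).+1 = (m - d)%N by lia.
  exact/IH/ltnW.
have := main m (leqnn m); rewrite subnn; apply: exec_mono.
by rewrite !leq_add2r leq_mul.
Qed.

(** The effect on a zipper of the instructions allowed by [local_instr]; being
    computable, it lets straight-line code be run by conversion. *)
Definition act (a : instr R) z : seq R * seq R :=
  let: (l, r) := z in
  match a with
  | Const (Posz k) c => (l, set_nth 0 r k c)
  | Copy (Posz k) (Posz i) => (l, set_nth 0 r k r`_i)
  | Add (Posz k) (Posz i) (Posz j) => (l, set_nth 0 r k (r`_i + r`_j))
  | Defs.Sub (Posz k) (Posz i) (Posz j) => (l, set_nth 0 r k (r`_i - r`_j))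
  | Mul (Posz k) (Posz i) (Posz j) => (l, set_nth 0 r k (r`_i * r`_j))
  | MoveL => (behead l, head 0 l :: r)
  | MoveR => (head 0 r :: l, behead r)
  | _ => z
  end.

Definition local_instr (a : instr R) : bool :=
  match a with
  | Const (Posz _) _ | Copy (Posz _) (Posz _) | Add (Posz _) (Posz _) (Posz _)
  | Defs.Sub (Posz _) (Posz _) (Posz _) | Mul (Posz _) (Posz _) (Posz _)
  | MoveL | MoveR => true
  | _ => false
  end.

Lemma upd_tape_of l r (k : nat) c :
  upd (tape_of (l, r)) k c = tape_of (l, set_nth 0 r k c).
Proof. by apply/funext => -[i|i] //=; rewrite /upd /= nth_set_nth. Qed.

Lemma tape_of_moveL l r :
  (fun i => tape_of (l, r) (i - 1)) = tape_of (behead l, head 0 l :: r).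
Proof.
apply/funext => -[[|i]|i].
- by case: l.
- by have -> : Posz i.+1 - 1 = Posz i by lia.
- have -> : Negz i - 1 = Negz i.+1 by lia.
  by rewrite /= nth_behead.
Qed.

Lemma tape_of_moveR l r :
  (fun i => tape_of (l, r) (i + 1)) = tape_of (head 0 r :: l, behead r).
Proof.
apply/funext => -[i|[|i]].
- by rewrite -PoszD addn1 /= nth_behead.
- by have -> : Negz 0 + 1 = 0 by []; case: r.
- by have -> : Negz i.+1 + 1 = Negz i by lia.
Qed.

Lemma step_act M q a z : local_instr a -> nth Halt M q = a ->
  step M (q, tape_of z) = Some (q.+1, tape_of (act a z)).
Proof.
case: z => l r; rewrite /step /cur_instr => + /= ->.
case: a => //.
- by move=> [k|//] c _; rewrite upd_tape_of.
- by move=> [k|//] [i|//] _; rewrite upd_tape_of.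
- by move=> [k|//] [i|//] [j|//] _; rewrite upd_tape_of.
- by move=> [k|//] [i|//] [j|//] _; rewrite upd_tape_of.
- by move=> [k|//] [i|//] [j|//] _; rewrite upd_tape_of.
- by move=> _; rewrite tape_of_moveL.
- by move=> _; rewrite tape_of_moveR.
Qed.

Lemma runs_op a z : local_instr a -> runs (Op a) z (act a z).
Proof.
move=> La pre post k x; rewrite cost_op add1n addn1 => H.
by rewrite (exec_step _ (step_act _ La (nth_code _ _ _))).
Qed.

Fixpoint unroll (f : nat -> cmd) (n : nat) : cmd :=
  if n is m.+1 then Seq (unroll f m) (f m) else Skip.

Lemma runs_unroll f n (z : nat -> seq R * seq R) :
  (forall k, (k < n)%N -> runs (f k) (z k) (z k.+1)) ->
  runs (unroll f n) (z 0%N) (z n).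
Proof.
elim: n => [_|n IH H] /=; first exact: runs_skip.
by apply: runs_seq (H n (ltnSn n)); apply: IH => k /ltnW; exact: H.
Qed.

(** Past the last instruction the flowchart reads its default, Halt. *)
Lemma runs_outputs c w l w' :
  runs c ([::], (size w)%:R :: w) (l, (size w')%:R :: w') ->
  outputs_within (compile 0 c) w (cost c).[B] w'.
Proof.
move=> H; exists (tape_of (l, (size w')%:R :: w')); last by split.
have := H [::] [::] 0%N (tape_of (l, (size w')%:R :: w')).
rewrite cat0s cats0 addn0 add0n load_tape_of; apply.
by apply: exec_halt; rewrite nth_default // size_compile.
Qed.

End Structured.

(** * Registers and addressable memory *)

(** The twelve registers sit at the head.  Their addresses: the constant 1, the
    position in the memory (counted from 1), the target of a memory access; the
    address of the current term, that of the best term so far, the length of the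
    memory; the largest value so far, the value of the current term, a sign, two
    accumulators, the length of the original memory. *)
Notation rOne := 0%N (only parsing).
Notation rPos := 1%N (only parsing).
Notation rTgt := 2%N (only parsing).
Notation rBlk := 3%N (only parsing).
Notation rBest := 4%N (only parsing).
Notation rOut := 5%N (only parsing).
Notation rMax := 6%N (only parsing).
Notation rVal := 7%N (only parsing).
Notation rSgn := 8%N (only parsing).
Notation rX := 9%N (only parsing).
Notation rY := 10%N (only parsing).
Notation rEnd := 11%N (only parsing).

Section Memory.
Variables (R : realType) (B : nat).
Implicit Types (l r rs L : seq R) (z : seq R * seq R).
Local Notation runs := (runs B).
Local Notation cmd := (cmd R).

Definition ops (s : seq (instr R)) : cmd := foldr (fun a c => Seq (Op a) c) (Skip R) s.

Lemma runs_ops s z z' :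
  all (@local_instr R) s -> foldl (fun z a => act a z) z s = z' ->
  runs (ops s) z z'.
Proof.
move=> + <-; elim: s z => [|a s IH] z /=; first by move=> _; exact: runs_skip.
by case/andP=> la ls; apply: runs_seq; [exact: runs_op | exact: IH].
Qed.

Lemma set_nth_cat r s k c : (k < size r)%N ->
  set_nth 0 (r ++ s) k c = set_nth 0 r k c ++ s.
Proof. by elim: r k => // d r IH [|k] //= kr; rewrite IH. Qed.

Definition nregs := 12%N.

(** The cell to the right of the registers is moved to their left.  Register 0
    is the buffer, which costs nothing since it always holds 1. *)
Definition shift_right : cmd :=
  ops (Copy rOne nregs ::
    [seq Copy (nregs - i)%N (nregs - i.+1)%N | i : nat <- iota 0 nregs.-1] ++
     [:: MoveR; Const rOne 1; Add rPos rPos rOne]).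

Definition shift_left : cmd :=
  ops (MoveL :: [seq Copy i i.+1 | i : nat <- iota 1 nregs.-1]
    ++ [:: Copy nregs rOne; Const rOne 1; Defs.Sub rPos rPos rOne]).

Lemma runs_shift_right l p rs d r : size rs = 10%N ->
  runs shift_right (l, [:: 1, p & rs ++ d :: r]) (d :: l, [:: 1, p + 1 & rs ++ r]).
Proof.
by do 10![case: rs => // ? rs]; case: rs => // _; exact: runs_ops.
Qed.

Lemma runs_shift_left l p rs d r : size rs = 10%N ->
  runs shift_left (d :: l, [:: 1, p & rs ++ r]) (l, [:: 1, p - 1 & rs ++ d :: r]).
Proof.
by do 10![case: rs => // ? rs]; case: rs => // _; exact: runs_ops.
Qed.

(** The memory L with the registers inserted just before its cell number k.  The
    position register holds k+1, so that comparing it with the constant 1 tells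
    when the registers are back at the beginning. *)
Definition at_cell (k : nat) (tgt : R) rs L : seq R * seq R :=
  (rev (take k L), [:: 1, k.+1%:R, tgt & rs ++ drop k L]).

Definition home rs L : seq R * seq R := ([::], [:: 1, 1, 0 & rs ++ L]).

Definition visit (c : cmd) : cmd :=
  Seq (Until rTgt rPos shift_right) (Seq c (Until rPos rOne shift_left)).

Lemma runs_goto k rs L : size rs = 9%N -> (k <= size L)%N -> (k <= B)%N ->
  runs (Until rTgt rPos shift_right) (at_cell 0 k.+1%:R rs L) (at_cell k k.+1%:R rs L).
Proof.
move=> rs9 kL kB.
apply: (@runs_until _ _ _ _ _ k (fun i => at_cell i k.+1%:R rs L)) => // i ik.
split; first by rewrite /= ltr_nat.
have iL : (i < size L)%N by apply: leq_trans kL.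
rewrite /at_cell (drop_nth 0 iL) (take_nth 0 iL) rev_rcons.
rewrite -[i.+2%:R]natr1.
by apply: (@runs_shift_right _ _ (k.+1%:R :: rs)); rewrite /= rs9.
Qed.

Lemma runs_return k tgt rs L : size rs = 9%N -> (k <= size L)%N -> (k <= B)%N ->
  runs (Until rPos rOne shift_left) (at_cell k tgt rs L) (at_cell 0 tgt rs L).
Proof.
move=> rs9 kL kB.
have := @runs_until _ B 1 0 shift_left k (fun i => at_cell (k - i) tgt rs L) kB.
rewrite subn0 subnn; apply => // i ik.
split; first by rewrite /= ltr1n ltnS subn_gt0.
have iL : (k - i.+1 < size L)%N by lia.
rewrite -subnSK // /at_cell (take_nth 0 iL) rev_rcons (drop_nth 0 iL).
have -> : (k - i.+1).+1%:R = (k - i.+1).+2%:R - 1 :> R by rewrite -[in RHS]natr1 addrK.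
by apply: (@runs_shift_left _ _ (tgt :: rs)); rewrite /= rs9.
Qed.

Lemma runs_visit c k tgt rs L rs' L' :
    size rs = 9%N -> size rs' = 9%N ->
    (k <= size L)%N -> (k <= size L')%N -> (k <= B)%N ->
    runs c (at_cell k k.+1%:R rs L) (at_cell k tgt rs' L') ->
  runs (visit c) (at_cell 0 k.+1%:R rs L) (at_cell 0 tgt rs' L').
Proof.
move=> rs9 rs9' kL kL' kB Hc.
apply: (runs_seq (runs_goto rs9 kL kB)); apply: (runs_seq Hc).
exact: runs_return.
Qed.

(** Reads the memory at the address x_a + off, known only at run time.  The
    target register is cleared afterwards, which brings the registers back to the
    form [home]. *)
Definition Fetch (u a off : nat) : cmd :=
  Seq (ops [:: Const rTgt off.+1%:R; Add rTgt rTgt a])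
    (Seq (visit (Op (Copy u nregs))) (ops [:: Const rTgt 0])).

Lemma runs_fetch u a off k rs L :
    size rs = 9%N -> (u < 9)%N -> (a < nregs)%N ->
    [:: 1, 1, off.+1%:R & rs]`_a = k%:R ->
    (k + off < size L)%N -> (k + off <= B)%N ->
  runs (Fetch u.+3 a off) (home rs L) (home (set_nth 0 rs u L`_(k + off)) L).
Proof.
move=> rs9 u9 aK ak kL kB.
have rs9' : size (set_nth 0 rs u L`_(k + off)) = 9%N.
  by rewrite size_set_nth rs9; apply/maxn_idPr.
apply: (@runs_seq _ _ _ _ _ (at_cell 0 (k + off).+1%:R rs L)).
  apply: runs_ops => //; rewrite /at_cell /home take0 drop0 [LHS]/=.
  congr ([::], [:: _, _, _ & _]).
  rewrite -[_ :: _ :: _ :: _]/([:: 1, 1, off.+1%:R & rs] ++ L) nth_cat /= rs9 aK.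
  by rewrite ak -natrD addSn addnC.
apply: (@runs_seq _ _ _ _ _
  (at_cell 0 (k + off).+1%:R (set_nth 0 rs u L`_(k + off)) L)).
  apply: (runs_visit rs9 rs9' (ltnW kL) (ltnW kL) kB).
  have -> : at_cell (k + off) (k + off).+1%:R (set_nth 0 rs u L`_(k + off)) L =
      act (Copy u.+3 nregs) (at_cell (k + off) (k + off).+1%:R rs L).
    rewrite /at_cell /= set_nth_cat ?rs9 // nth_cat rs9 subnn.
    by rewrite (drop_nth 0 kL).
  exact: runs_op.
by apply: runs_ops => //=; rewrite /at_cell take0 drop0.
Qed.

(** Writes x_u at the first free address, which extends the list L by one. *)
Definition Emit (u : nat) : cmd :=
  Seq (ops [:: Const rTgt 1; Add rTgt rTgt rOut])
    (Seq (visit (Op (Copy nregs u))) (ops [:: Const rTgt 0; Add rOut rOut rOne])).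

Lemma runs_emit u rs L :
    size rs = 9%N -> (u < 9)%N -> rs`_2 = (size L)%:R -> (size L <= B)%N ->
  runs (Emit u.+3) (home rs L)
    (home (set_nth 0 rs 2 (size L).+1%:R) (rcons L rs`_u)).
Proof.
move=> rs9 u9 out LB.
have rs9' : size (set_nth 0 rs 2 (size L).+1%:R) = 9%N by rewrite size_set_nth rs9.
pose L' := rcons L rs`_u.
have LL' : (size L <= size L')%N by rewrite size_rcons.
apply: (@runs_seq _ _ _ _ _ (at_cell 0 (size L).+1%:R rs L)).
  apply: runs_ops => //; rewrite /at_cell /home take0 drop0 [LHS]/=.
  by rewrite nth_cat rs9 /= out nat1r.
apply: (@runs_seq _ _ _ _ _ (at_cell 0 (size L).+1%:R rs L')).
  apply: (runs_visit rs9 rs9 (leqnn _) LL' LB).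
  have -> : at_cell (size L) (size L).+1%:R rs L' =
      act (Copy nregs u.+3) (at_cell (size L) (size L).+1%:R rs L).
    rewrite /at_cell /L' -cats1 take_size_cat // drop_size_cat // take_size drop_size.
    by rewrite /= cats0 set_nthE rs9 ltnn subnn.
  exact: runs_op.
apply: runs_ops => //=; rewrite /at_cell take0 drop0 /home /=.
by rewrite nth_cat rs9 /= out natr1 set_nth_cat ?rs9.
Qed.

End Memory.

(** * The program *)

Section Program.
Variables (R : realType) (n : nat).
Local Notation cmd := (cmd R).

(** The memory starts with the length of the input, so r occupies the addresses
    from 1 to n.  The scratch registers are cleared by every command, so that the
    states between commands depend on meaningful data only. *)
Definition Eval : cmd :=
  Seq (unroll (fun i => Seq (Fetch R rX rBlk i) (Seq (Fetch R rY rOne i)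
         (ops [:: Mul rX rX rY; Add rVal rVal rX; Const rX 0; Const rY 0]))) n)
    (Seq (Fetch R rX rBlk n) (ops [:: Add rVal rVal rX; Const rX 0])).

(** The normal vector of a half-space is current minus best, its right-hand side
    is best minus current: b selects the order. *)
Definition EmitDiff (b : bool) (i : nat) : cmd :=
  Seq (Fetch R rX (if b then rBest else rBlk) i)
    (Seq (Fetch R rY (if b then rBlk else rBest) i)
      (Seq (ops [:: Defs.Sub rX rX rY; Mul rX rSgn rX])
        (Seq (Emit R rX) (ops [:: Const rX 0; Const rY 0])))).

Definition EmitHalfspace : cmd :=
  Seq (unroll (EmitDiff false) n) (EmitDiff true n).

Definition NextBlock : cmd :=
  ops [:: Const rX n.+2%:R; Add rBlk rBlk rX; Const rX 0].

Definition Start : cmd :=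
  Seq (ops (nseq nregs MoveL ++ [:: Const rOne 1; Const rPos 1]))
    (Seq (Fetch R rEnd rBlk 0)
      (ops [:: Add rEnd rEnd rOne; Copy rOut rEnd])).

(** The 2(t-1) half-spaces take 2(n+1)(t-1) cells, where t is recovered from the
    length n+1+(n+2)t held in x_End. *)
Definition EmitSize : cmd :=
  let c : R := 2%:R * n.+1%:R / n.+2%:R in
  Seq (ops [:: Const rX c; Mul rX rX rEnd; Const rY (c * n.+1%:R + 2%:R * n.+1%:R);
               Defs.Sub rX rX rY])
    (Seq (Emit R rX)
      (ops [:: Const rX 0; Const rY 0; Const rBlk n.+1%:R; Const rBest n.+1%:R])).

Definition FindBest : cmd :=
  Seq Eval (Seq (ops [:: Copy rMax rVal; Const rVal 0])
    (Until rEnd rBlk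
      (Seq Eval (Seq (Unless rVal rMax (ops [:: Copy rMax rVal; Copy rBest rBlk]))
        (Seq (ops [:: Const rVal 0]) NextBlock))))).

Definition EmitTerm : cmd :=
  Seq (ops [:: Const rX 0; Const rSgn 1])
    (Seq EmitHalfspace (Seq Eval (Seq (ops [:: Const rSgn (-1)])
      (Seq (Unless rMax rVal (ops [:: Const rSgn 1]))
        (Seq EmitHalfspace (ops [:: Const rVal 0; Const rSgn 0])))))).

(** The best term itself, which would give a zero normal vector, is recognized
    by the square of the difference of the addresses. *)
Definition EmitAll : cmd :=
  Until rEnd rBlk
    (Seq (ops [:: Defs.Sub rX rBlk rBest; Mul rX rX rX])
      (Seq (Unless rX rY EmitTerm) NextBlock)).

(** The registers are moved to the beginning of the output and the head is then
    moved past them, where the output is to be read. *)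
Definition Finish : cmd :=
  Seq (ops [:: Const rTgt 1; Add rTgt rTgt rEnd])
    (Seq (Until rTgt rPos (shift_right R)) (ops (nseq nregs MoveR))).

Definition program : cmd :=
  Seq Start (Seq EmitSize (Seq FindBest
    (Seq (ops [:: Const rBlk n.+1%:R]) (Seq EmitAll Finish)))).

Variable B : nat.
Local Notation runs := (runs B).

Definition state (blk best : nat) (mx val sgn : R) (fin : nat) (L : seq R) :=
  home [:: blk%:R; best%:R; (size L)%:R; mx; val; sgn; 0; 0; fin%:R] L.

Lemma runs_eval blk best mx val sgn fin L :
    (blk + n < size L)%N -> (size L <= B)%N ->
  runs Eval (state blk best mx val sgn fin L)
    (state blk best mx
      (val + (\sum_(0 <= i < n) L`_(blk + i) * L`_(1 + i) + L`_(blk + n)))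
      sgn fin L).
Proof.
move=> szL LB.
pose v i := val + \sum_(0 <= j < i) L`_(blk + j) * L`_(1 + j).
apply: (@runs_seq _ _ _ _ _ (state blk best mx (v n) sgn fin L)).
  have -> : val = v 0%N by rewrite /v big_geq // addr0.
  apply: (@runs_unroll _ _ _ _ (fun i => state blk best mx (v i) sgn fin L)) => i ilt.
  apply: runs_seq; first by apply: (@runs_fetch _ _ _ _ _ blk) => //; lia.
  apply: runs_seq; first by apply: (@runs_fetch _ _ _ _ _ 1) => //; lia.
  by apply: runs_ops => //; rewrite /v big_nat_recr //= addrA.
apply: runs_seq; first by apply: (@runs_fetch _ _ _ _ _ blk) => //; lia.
by apply: runs_ops => //; rewrite /state /v addrA.
Qed.

Lemma runs_emit_diff (b : bool) i blk best mx val sgn fin L :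
    let p := if b then best else blk in let q := if b then blk else best in
    (p + i < size L)%N -> (q + i < size L)%N -> (size L <= B)%N ->
  runs (EmitDiff b i) (state blk best mx val sgn fin L)
    (state blk best mx val sgn fin
       (rcons L (sgn * (L`_(p + i) - L`_(q + i))))).
Proof.
move=> p q pL qL LB.
apply: runs_seq; first by apply: (@runs_fetch _ _ _ _ _ p) => //;
  (by rewrite ?/p; case: (b)) || lia.
apply: runs_seq; first by apply: (@runs_fetch _ _ _ _ _ q) => //;
  (by rewrite ?/q; case: (b)) || lia.
apply: (@runs_seq _ _ _ _ _ (home [:: blk%:R; best%:R; (size L)%:R; mx; val; sgn;
    sgn * (L`_(p + i) - L`_(q + i)); L`_(q + i); fin%:R] L)).
  exact: runs_ops.
apply: runs_seq; first by apply: (@runs_emit _ _ 6).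
by apply: runs_ops => //; rewrite /state size_rcons.
Qed.

Definition halfspace_cells blk best sgn (L : seq R) : seq R :=
  rcons (mkseq (fun i => sgn * (L`_(blk + i) - L`_(best + i))) n)
    (sgn * (L`_(best + n) - L`_(blk + n))).

Lemma runs_emit_halfspace blk best mx val sgn fin L :
    (blk + n < size L)%N -> (best + n < size L)%N -> (size L + n < B)%N ->
  runs EmitHalfspace (state blk best mx val sgn fin L)
    (state blk best mx val sgn fin (L ++ halfspace_cells blk best sgn L)).
Proof.
move=> blkL bestL LB; rewrite /halfspace_cells.
set f := fun i : nat => _.
apply: (@runs_seq _ _ _ _ _ (state blk best mx val sgn fin (L ++ mkseq f n))).
  rewrite -[X in state _ _ _ _ _ _ X](cats0 L).
  apply: (@runs_unroll _ _ _ _ (fun i => state blk best mx val sgn fin (L ++ mkseq f i))).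
  move=> i ilt; rewrite mkseqS -rcons_cat /f.
  have Lcat p : (p + n < size L)%N -> (L ++ mkseq f i)`_(p + i) = L`_(p + i).
    by move=> pL; rewrite nth_cat; case: ltnP => // /(leq_trans pL); lia.
  rewrite -[L`_(blk + i)]Lcat // -[L`_(best + i)]Lcat //.
  by apply: (@runs_emit_diff false); rewrite size_cat size_mkseq; lia.
have Lcat p : (p + n < size L)%N -> L`_(p + n) = (L ++ mkseq f n)`_(p + n).
  by move=> pL; rewrite nth_cat pL.
rewrite -rcons_cat !Lcat //.
by apply: (@runs_emit_diff true); rewrite size_cat size_mkseq; lia.
Qed.

(** ** Running on an encoded exponential sum *)

Variables (r : 'rV[R]_n) (a : nat -> 'rV[R]_n) (b : nat -> R).

Definition value (k : nat) : R := dotv (a k) r + b k.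

Fixpoint best_term (m : nat) : nat :=
  if m is m'.+1 then
    if value m' <= value (best_term m') then best_term m' else m'
  else 0.

Definition dominance (j k : nat) (s : R) : 'rV[R]_n * R :=
  (s *: (a k - a j), s * (b j - b k)).

(** Two half-spaces are written for every k, whether or not it ties with j at r
    (without a tie the same one is repeated), so that the length of the output
    is known before any of it is written. *)
Definition dominances (j k : nat) : seq ('rV[R]_n * R) :=
  if k == j then [::]
  else [:: dominance j k 1; dominance j k (if value j <= value k then -1 else 1)].

Definition output (t : nat) : seq ('rV[R]_n * R) :=
  flatten [seq dominances (best_term t) k | k <- iota 0 t].

Lemma best_term_lt m : (0 < m)%N -> (best_term m < m)%N.
Proof.
case: m => // m _; elim: m => [|m IH] /=; first by case: ifP.
by rewrite -/(best_term m.+1); case: ifP => // _; exact: ltnW.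
Qed.

Lemma best_term_max m k : (k < m)%N -> value k <= value (best_term m).
Proof.
elim: m => // m IH; rewrite ltnS leq_eqVlt => /orP[/eqP ->|/IH le_k] /=.
  by case: ifP => // _; exact: lexx.
case: ifP => // /negbT; rewrite -ltNge => /ltW; exact: le_trans.
Qed.

Lemma size_dominances j k : size (dominances j k) = (2 * (k != j))%N.
Proof. by rewrite /dominances; case: eqP. Qed.

Lemma size_output t : (0 < t)%N -> size (output t) = (2 * t.-1)%N.
Proof.
move=> t0; rewrite /output size_flatten /shape -map_comp sumnE big_map.
rewrite (eq_bigr (fun k => 2 * (k != best_term t))%N); last first.
  by move=> k _; rewrite /= size_dominances.
rewrite -big_distrr /=; congr (_ * _)%N.
rewrite -[in iota 0 _](subn0 t) -/(index_iota 0 t) big_mkord.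
rewrite (bigD1 (Ordinal (best_term_lt t0))) //= eqxx add0n.
rewrite (eq_bigr (fun=> 1%N)).
  by rewrite sum1_card cardC1 card_ord.
by move=> i; rewrite -val_eqE /= => ->.
Qed.

Lemma size_encode_halfspaces (hs : seq ('rV[R]_n * R)) :
  size (encode_halfspaces hs) = (size hs * n.+1)%N.
Proof.
rewrite /encode_halfspaces; elim: hs => //= h hs IH.
by rewrite size_cat IH size_rcons size_map size_enum_ord mulSn.
Qed.

Variables (t : nat) (w : seq R).
Hypothesis t_gt0 : (0 < t)%N.
Hypothesis size_w : size w = (n + t * n.+2)%N.
Hypothesis w_r : forall i : 'I_n, w`_i = r 0 i.
Hypothesis w_a : forall k (i : 'I_n), (k < t)%N -> w`_(n + k * n.+2 + i) = a k 0 i.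
Hypothesis w_b : forall k, (k < t)%N -> w`_(n + k * n.+2 + n) = b k.

Let L0 : seq R := (size w)%:R :: w.
(** Term k takes n+2 cells, the last of which is Im(beta_k). *)
Definition block (k : nat) : nat := (n.+1 + k * n.+2)%N.

Lemma size_L0 : size L0 = block t.
Proof. by rewrite /= size_w. Qed.

Lemma block_lt k : (k < t)%N -> (block k + n < size L0)%N.
Proof.
move=> kt; rewrite size_L0 /block.
have : (k.+1 * n.+2 <= t * n.+2)%N by rewrite leq_mul2r kt orbT.
rewrite mulSn; lia.
Qed.

Lemma block_coef L k (i : 'I_n) : (k < t)%N -> (L0 ++ L)`_(block k + i) = a k 0 i.
Proof.
move=> kt; rewrite nth_cat ifT; first by rewrite /block !addSn /= w_a.
by apply: leq_trans (block_lt kt); rewrite ltnS leq_add2l ltnW.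
Qed.

Lemma block_const L k : (k < t)%N -> (L0 ++ L)`_(block k + n) = b k.
Proof.
by move=> kt; rewrite nth_cat block_lt // /block !addSn /= w_b.
Qed.

Lemma runs_eval_block k best mx sgn fin L :
    (k < t)%N -> (size (L0 ++ L) <= B)%N ->
  runs Eval (state (block k) best mx 0 sgn fin (L0 ++ L))
    (state (block k) best mx (value k) sgn fin (L0 ++ L)).
Proof.
move=> kt LB; have kL : (block k + n < size (L0 ++ L))%N.
  by rewrite size_cat ltn_addr // block_lt.
have := @runs_eval (block k) best mx 0 sgn fin _ kL LB.
rewrite add0r block_const // big_mkord.
rewrite (eq_bigr (fun i => a k 0 i * r 0 i)) // => i _.
rewrite block_coef // nth_cat ifT /=; first by rewrite w_r.
by rewrite size_w; have := ltn_ord i; lia.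
Qed.

Lemma runs_emit_dominance j k mx val sgn fin L :
    (j < t)%N -> (k < t)%N -> (size (L0 ++ L) + n < B)%N ->
  runs EmitHalfspace (state (block k) (block j) mx val sgn fin (L0 ++ L))
    (state (block k) (block j) mx val sgn fin
       (L0 ++ L ++ encode_halfspaces [:: dominance j k sgn])).
Proof.
move=> jt kt LB.
have blk_lt i : (i < t)%N -> (block i + n < size (L0 ++ L))%N.
  by move=> it; rewrite size_cat ltn_addr // block_lt.
have := @runs_emit_halfspace (block k) (block j) mx val sgn fin (L0 ++ L)
  (blk_lt _ kt) (blk_lt _ jt) LB.
congr (runs _ _ (state _ _ _ _ _ _ _)); rewrite -catA; congr (_ ++ (_ ++ _)).
rewrite /encode_halfspaces /= cats0 /halfspace_cells !block_const //.
congr rcons; rewrite /mkseq -val_enum_ord -map_comp; apply: eq_map => i.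
rewrite -[LHS]/(sgn * ((L0 ++ L)`_(block k + i) - (L0 ++ L)`_(block j + i))).
by rewrite !block_coef // !mxE.
Qed.

Lemma runs_next_block k best mx val sgn fin L :
  runs NextBlock (state (block k) best mx val sgn fin L)
    (state (block k.+1) best mx val sgn fin L).
Proof.
apply: runs_ops => //; rewrite /state /=; congr ([::], [:: _, _, _, _ & _]).
by rewrite -natrD /block mulSn addnCA addnC.
Qed.

Hypothesis outB : (block t + 1 + 2 * t.-1 * n.+1 <= B)%N.

Lemma runs_start : runs Start ([::], L0) (state 0 0 0 0 0 (block t) L0).
Proof.
apply: (@runs_seq _ _ _ _ _ (home (nseq 9 0) L0)); first exact: runs_ops.
apply: runs_seq; first by apply: (@runs_fetch _ _ _ _ _ 0) => //; lia.
by apply: runs_ops => //=; rewrite natr1 -size_L0.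
Qed.

Let J := best_term t.
Let L1 : seq R := rcons L0 (2 * t.-1 * n.+1)%:R.
Let size_L1 : size L1 = (block t).+1.
Proof. by rewrite size_rcons size_L0. Qed.
Let jt : (J < t)%N. Proof. exact: best_term_lt. Qed.

Let tB : (t <= B)%N.
Proof. by apply: leq_trans outB; rewrite /block mulnS; lia. Qed.

Lemma runs_emit_size : runs EmitSize (state 0 0 0 0 0 (block t) L0)
  (state (block 0) (block 0) 0 0 0 (block t) L1).
Proof.
set c : R := 2%:R * n.+1%:R / n.+2%:R.
set d : R := c * n.+1%:R + 2%:R * n.+1%:R.
apply: (@runs_seq _ _ _ _ _
  (home [:: 0; 0; (size L0)%:R; 0; 0; 0; c * (block t)%:R - d; d; (block t)%:R] L0)).
  exact: runs_ops.
have -> : c * (block t)%:R - d = (2 * t.-1 * n.+1)%:R.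
  have t1 : t%:R = t.-1%:R + 1 :> R by rewrite natr1 prednK.
  rewrite /d /c /block natrD !natrM t1; field.
  by rewrite -natrD pnatr_eq0.
apply: runs_seq; first by apply: (@runs_emit _ _ 6) => //; rewrite size_L0; lia.
by apply: runs_ops => //=; rewrite /state /block /= addn0 size_rcons.
Qed.

Lemma runs_find_best : runs FindBest
  (state (block 0) (block 0) 0 0 0 (block t) L1)
  (state (block t) (block J) (value J) 0 0 (block t) L1).
Proof.
have LB : (size (L0 ++ [:: (2 * t.-1 * n.+1)%:R]) <= B)%N.
  by rewrite cats1 size_L1; lia.
have eval k j mx : (k < t)%N -> runs Eval
    (state (block k) j mx 0 0 (block t) L1)
    (state (block k) j mx (value k) 0 (block t) L1).
  by rewrite /L1 -cats1 => kt; exact: runs_eval_block.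
apply: runs_seq; first exact: eval.
apply: runs_seq; first exact: runs_ops.
pose z m := state (block m) (block (best_term m)) (value (best_term m)) 0 0 (block t) L1.
apply: (@runs_until _ _ _ _ _ t z) => //.
move=> m mt; split.
  by rewrite /= ltr_nat; have := block_lt mt; rewrite size_L0; lia.
apply: runs_seq; first exact: eval.
apply: (@runs_seq _ _ _ _ _ (state (block m) (block (best_term m.+1))
    (value (best_term m.+1)) (value m) 0 (block t) L1)).
  rewrite [best_term m.+1]/=; case: leP => lt_v; first exact: runs_unless_skip.
  by apply: runs_unless => //; exact: runs_ops.
apply: runs_seq; first exact: runs_ops.
exact: runs_next_block.
Qed.

Lemma runs_emit_term k x L : (k < t)%N -> k != J ->
    (size (L0 ++ L) + 2 * n.+1 <= B)%N ->
  runs EmitTerm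
    (home [:: (block k)%:R; (block J)%:R; (size (L0 ++ L))%:R; value J; 0; 0;
              x; 0; (block t)%:R] (L0 ++ L))
    (state (block k) (block J) (value J) 0 0 (block t)
       (L0 ++ L ++ encode_halfspaces (dominances J k))).
Proof.
move=> kt kJ LB.
apply: (@runs_seq _ _ _ _ _
  (state (block k) (block J) (value J) 0 1 (block t) (L0 ++ L))).
  exact: runs_ops.
apply: runs_seq; first by apply: runs_emit_dominance => //; lia.
have szL s : size (L0 ++ L ++ encode_halfspaces [:: dominance J k s]) =
    (size (L0 ++ L) + n.+1)%N.
  by rewrite catA size_cat size_encode_halfspaces mul1n.
apply: runs_seq; first by apply: runs_eval_block => //; rewrite szL; lia.
apply: runs_seq; first exact: runs_ops.
apply: (@runs_seq _ _ _ _ _ (state (block k) (block J) (value J) (value k)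
   (if value J <= value k then -1 else 1) (block t)
   (L0 ++ L ++ encode_halfspaces [:: dominance J k 1]))).
  case: leP => lt_v; first exact: runs_unless_skip.
  by apply: runs_unless => //; exact: runs_ops.
apply: runs_seq; first by apply: runs_emit_dominance => //; rewrite szL; lia.
apply: runs_ops => //; rewrite /dominances (negPf kJ) /encode_halfspaces /= !cats0.
by rewrite -!catA.
Qed.

Let out m := L0 ++ (2 * t.-1 * n.+1)%:R ::
  encode_halfspaces (flatten [seq dominances J k | k <- iota 0 m]).

Lemma encode_halfspaces_cat (h1 h2 : seq ('rV[R]_n * R)) :
  encode_halfspaces (h1 ++ h2) = encode_halfspaces h1 ++ encode_halfspaces h2.
Proof. by rewrite /encode_halfspaces map_cat flatten_cat. Qed.

Lemma outS m : out m.+1 = out m ++ encode_halfspaces (dominances J m).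
Proof.
rewrite /out -[m.+1]addn1 iotaD map_cat flatten_cat /= cats0 encode_halfspaces_cat.
by rewrite -catA.
Qed.

Lemma size_out m : size (out m) =
  (block t + 1 + size (flatten [seq dominances J k | k <- iota 0 m]) * n.+1)%N.
Proof. by rewrite size_cat size_L0 -cat1s size_cat size_encode_halfspaces addnA. Qed.

Lemma size_out_end : size (out t) = (block t + 1 + 2 * t.-1 * n.+1)%N.
Proof. by rewrite size_out -/(output t) size_output. Qed.

Lemma size_out_le m : (m <= t)%N -> (size (out m) <= size (out t))%N.
Proof.
move=> mt; rewrite !size_out leq_add2l leq_mul2r /= -[in X in (_ <= X)%N](subnKC mt).
by rewrite iotaD map_cat flatten_cat size_cat leq_addr.
Qed.

Lemma runs_emit_all : runs EmitAll
  (state (block 0) (block J) (value J) 0 0 (block t) (out 0))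
  (state (block t) (block J) (value J) 0 0 (block t) (out t)).
Proof.
pose z m := state (block m) (block J) (value J) 0 0 (block t) (out m).
apply: (@runs_until _ _ _ _ _ t z) => //.
move=> m mt; split.
  by rewrite /= ltr_nat; have := block_lt mt; rewrite size_L0; lia.
apply: (@runs_seq _ _ _ _ _
  (home [:: (block m)%:R; (block J)%:R; (size (out m))%:R; value J; 0; 0;
     ((block m)%:R - (block J)%:R) * ((block m)%:R - (block J)%:R); 0;
     (block t)%:R] (out m))).
  exact: runs_ops.
apply: runs_seq; last exact: runs_next_block.
have [->|mJ] := eqVneq m J.
  rewrite subrr mul0r outS /dominances eqxx cats0; exact: runs_unless_skip.
apply: runs_unless.
  rewrite /= -expr2 exprn_even_gt0 //= subr_eq0 eqr_nat.
  by apply: contra mJ => /eqP; rewrite /block; nia.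
rewrite outS /out -[X in state _ _ _ _ _ _ X]catA; apply: runs_emit_term => //.
apply: leq_trans outB; rewrite -size_out_end; apply: leq_trans (size_out_le mt).
by rewrite outS [leqRHS]size_cat size_encode_halfspaces size_dominances mJ.
Qed.

Lemma runs_finish : exists l, runs Finish
  (state (block t) (block J) (value J) 0 0 (block t) (out t))
  (l, (2 * t.-1 * n.+1)%:R :: encode_halfspaces (output t)).
Proof.
have out9 : size [:: (block t)%:R; (block J)%:R; (size (out t))%:R; value J; 0; 0;
  0; 0; (block t)%:R : R] = 9%N by [].
have le_out : (block t <= size (out t))%N by rewrite size_out_end -addnA leq_addr.
eexists; apply: (@runs_seq _ _ _ _ _ (at_cell 0 (block t).+1%:R [:: (block t)%:R;
  (block J)%:R; (size (out t))%:R; value J; 0; 0; 0; 0; (block t)%:R] (out t))).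
  by apply: runs_ops => //; rewrite /at_cell take0 drop0 /= nat1r.
apply: runs_seq; first apply: runs_goto out9 le_out _.
  by apply: leq_trans outB; rewrite -addnA leq_addr.
by rewrite /at_cell /out drop_size_cat ?size_L0 //; apply: runs_ops.
Qed.

Lemma runs_program : outputs_within (compile 0 program) w (cost program).[B]
  (encode_halfspaces (output t)).
Proof.
have [l Hl] := runs_finish.
apply: (@runs_outputs _ _ _ _ l).
rewrite size_encode_halfspaces size_output //.
apply: runs_seq; first exact: runs_start.
apply: runs_seq; first exact: runs_emit_size.
apply: runs_seq; first exact: runs_find_best.
apply: (@runs_seq _ _ _ _ _
  (state (block 0) (block J) (value J) 0 0 (block t) (out 0))).
  by apply: runs_ops => //; rewrite /out /= cats1 -/L1 /state /block addn0.
exact: runs_seq runs_emit_all Hl.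
Qed.

End Program.

(** * The cells of a tropical variety *)

Section Geometry.
Variables (R : realType) (n : nat).
Implicit Types x y v c : 'rV[R]_n.

Lemma dotvDr c x y : dotv c (x + y) = dotv c x + dotv c y.
Proof. by rewrite /dotv -big_split; apply: eq_bigr => i _; rewrite mxE mulrDr. Qed.

Lemma dotvZr c k x : dotv c (k *: x) = k * dotv c x.
Proof. by rewrite /dotv big_distrr; apply: eq_bigr => i _; rewrite mxE mulrCA. Qed.

Lemma dotvC x y : dotv x y = dotv y x.
Proof. by apply: eq_bigr => i _; rewrite mulrC. Qed.

Lemma dotvBl c c' x : dotv (c - c') x = dotv c x - dotv c' x.
Proof. by rewrite -scaleN1r dotvC dotvDr dotvZr mulN1r ![dotv x _]dotvC. Qed.

Lemma dotvZl k c x : dotv (k *: c) x = k * dotv c x.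
Proof. by rewrite dotvC dotvZr dotvC. Qed.

Lemma dotv_suml (I : finType) (P : pred I) (F : I -> 'rV[R]_n) x :
  dotv (\sum_(i | P i) F i) x = \sum_(i | P i) dotv (F i) x.
Proof.
rewrite dotvC (big_morph (dotv x) (dotvDr x) (id1 := 0)).
  by apply: eq_bigr => i _; rewrite dotvC.
by rewrite /dotv big1 // => i _; rewrite mxE mulr0.
Qed.

Lemma dotv_sumr c (k : nat) (w : 'I_k -> R) (p : 'I_k -> 'rV[R]_n) :
  dotv c (\sum_i w i *: p i) = \sum_i w i * dotv c (p i).
Proof.
by rewrite dotvC dotv_suml; apply: eq_bigr => i _; rewrite dotvZl dotvC.
Qed.

Lemma dotv_continuous c : continuous (dotv c).
Proof.
move=> x; apply: (cvg_big add_continuous (nbhs_filter x)) => i _.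
by apply: cvgM; [exact: cvg_cst | exact: coord_continuous].
Qed.

Lemma line_continuous x v : continuous (fun s : R => x + s *: v).
Proof.
move=> s; apply: cvgD; first exact: cvg_cst.
by apply: cvgZr_tmp; exact: cvg_id.
Qed.

Lemma nbhs_line x v (U : set 'rV[R]_n) : nbhs x U ->
  exists2 e : R, 0 < e & forall s, `|s| < e -> U (x + s *: v).
Proof.
move=> Ux; have : nbhs (0 : R) ((fun s : R => x + s *: v) @^-1` U).
  by apply: line_continuous; rewrite scale0r addr0.
move=> /nbhs_ballP[e /= e0 eU]; exists e => // s se.
by apply: eU; rewrite /ball /= sub0r normrN.
Qed.

(** ** Maxima of affine functions *)

Variables (t : nat) (a : 'I_t -> 'rV[R]_n) (b : 'I_t -> R).
Hypothesis a_inj : injective a.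

Definition aff (j : 'I_t) x : R := dotv (a j) x + b j.

Definition cell (j : 'I_t) : set 'rV[R]_n := [set x | forall k, aff k x <= aff j x].

Definition region (j : 'I_t) : set 'rV[R]_n :=
  [set x | forall k, k != j -> aff k x < aff j x].

(** The cell whose relative interior contains r.  This form does not refer to any
    one of the full-dimensional polyhedra of which it is a face. *)
Definition sigma r : set 'rV[R]_n := [set x | forall j, cell j r -> cell j x].

Lemma aff_continuous j : continuous (aff j).
Proof.
by move=> x; exact: (cvgD (@dotv_continuous (a j) x) (cvg_cst (b j))).
Qed.

Lemma aff_line j x v s : aff j (x + s *: v) = aff j x + s * dotv (a j) v.
Proof. by rewrite /aff dotvDr dotvZr addrAC. Qed.

Lemma region_sub_cell j : region j `<=` cell j.
Proof.
by move=> x jx k; have [->//|/jx/ltW] := eqVneq k j.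
Qed.

Lemma region_disjoint j k x : region j x -> cell k x -> j = k.
Proof.
by move=> jx kx; apply/eqP/negPn/negP; rewrite eq_sym => /jx; rewrite ltNge kx.
Qed.

Lemma near_lt j k x : aff k x < aff j x -> \forall y \near x, aff k y < aff j y.
Proof.
rewrite -subr_gt0 => lt0.
have cvx : (fun y => aff j y - aff k y) @ x --> aff j x - aff k x.
  exact: (cvgB (@aff_continuous j x) (@aff_continuous k x)).
have near0 := @cvgr_gt _ _ _ (nbhs_filter x) _ _ cvx 0 lt0.
by apply: (@filterS _ _ (nbhs_filter x) _ _ _ near0) => y /=; rewrite subr_gt0.
Qed.

Lemma near_forall (I : finType) (P : I -> 'rV[R]_n -> Prop) x :
  (forall i, nbhs x (P i)) -> nbhs x [set y | forall i, P i y].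
Proof. exact: (@filter_forall _ _ _ _ (nbhs_filter x)). Qed.

Lemma open_region j : open (region j).
Proof.
rewrite openE => x jx; apply: near_forall => k.
have [->|kj] := eqVneq k j; first by apply: filterE.
by apply: filterS (near_lt (jx _ kj)) => y ? _.
Qed.

Lemma closed_cell j : closed (cell j).
Proof.
move=> x clx k; rewrite leNgt; apply/negP => /near_lt /clx[y [jy]].
by rewrite ltNge jy.
Qed.

Lemma region_segment j x y s : region j x -> cell j y -> 0 < s -> s <= 1 ->
  region j (y + s *: (x - y)).
Proof.
move=> jx jy s0 s1 k kj.
have lin i : aff i (y + s *: (x - y)) = s * aff i x + (1 - s) * aff i y.
  by rewrite aff_line dotvDr -scaleN1r dotvZr /aff; ring.
rewrite !lin; apply: ltr_leD.
  by rewrite ltr_pM2l // jx.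
by rewrite ler_wpM2l ?jy // subr_ge0.
Qed.

(** The polyhedron is closed; conversely the half-open segment from a point x of
    the region to a point of the polyhedron stays in the region. *)
Lemma closure_region j x : region j x -> closure (region j) = cell j.
Proof.
move=> jx; apply/seteqP; split.
  rewrite [X in _ `<=` X](closure_id _).1; last exact: closed_cell.
  exact/closure_subset/region_sub_cell.
move=> y jy U /(nbhs_line (x - y))[e e0 eU].
pose s := Num.min (e / 2) 1.
have s0 : 0 < s by rewrite lt_min divr_gt0 //=.
exists (y + s *: (x - y)); split.
  by apply: region_segment => //; rewrite ge_min lexx orbT.
apply: eU; rewrite gtr0_norm //; apply: le_lt_trans (_ : e / 2 < e).
  by rewrite ge_min lexx.
by rewrite ltr_pdivrMr // ltr_pMr // ltr1n.
Qed.

Lemma dotv_gt0 v : v != 0 -> 0 < dotv v v.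
Proof.
move=> v0; rewrite lt_def andbC sumr_ge0 => [|i _]; last by rewrite -expr2 sqr_ge0.
apply: contra v0 => /eqP/psumr_eq0P v0; apply/eqP/rowP => i; rewrite mxE.
by apply/eqP; rewrite -sqrf_eq0 expr2 v0 // => k _; rewrite -expr2 sqr_ge0.
Qed.

Lemma dotv_lt_longest x y : x != y -> dotv x x <= dotv y y -> dotv x y < dotv y y.
Proof.
rewrite eq_sym -subr_eq0 => /dotv_gt0.
rewrite dotvBl ![dotv _ (y - x)]dotvC !dotvBl [dotv y x]dotvC; lra.
Qed.

Lemma cell_eq r j k : cell j r -> cell k r -> aff j r = aff k r.
Proof. by move=> jr kr; apply/le_anti; rewrite jr kr. Qed.

Lemma cell_lt r j k : cell j r -> ~ cell k r -> aff k r < aff j r.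
Proof.
move=> jr kr; rewrite ltNge; apply/negP => le_jk; apply: kr => i.
exact: le_trans le_jk.
Qed.

Lemma exists_cell r : (0 < t)%N -> exists j, cell j r.
Proof.
move=> t0; case: (@arg_maxP _ _ _ (Ordinal t0) xpredT (aff^~ r)) => // j _ jmax.
by exists j => k; exact: jmax.
Qed.

(** Near r only the comparisons that are equalities at r need to be examined. *)
Lemma near_strict r :
  nbhs r [set y | forall k j, aff k r < aff j r -> aff k y < aff j y].
Proof.
apply: near_forall => k; apply: near_forall => j.
have [le_jk|lt_kj] := leP (aff j r) (aff k r); first by apply: filterE => y; rewrite ltNge.
by apply: filterS (near_lt lt_kj) => y ? _.
Qed.

(** Among the terms dominating at r, the one with the longest frequency strictly
    dominates just beyond r in the direction of that frequency. *)
Lemma region_near r : (0 < t)%N -> exists j x, cell j r /\ region j x.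
Proof.
move=> /(exists_cell r)[j0 j0r].
have /(@arg_maxP _ _ _ j0 (fun j => `[< cell j r >]) (fun j => dotv (a j) (a j))) :
  `[< cell j0 r >] by exact/asboolP.
case=> j /asboolP jr jmax.
have [e e0 eU] := nbhs_line (a j) (near_strict r).
exists j, (r + (e / 2) *: a j); split=> // k kj.
have e2 : 0 < e / 2 by rewrite divr_gt0.
have [kr|/(cell_lt jr) lt_kj] := pselect (cell k r); last first.
  by apply: eU => //; rewrite gtr0_norm // ltr_pdivrMr // ltr_pMr // ltr1n.
rewrite !aff_line (cell_eq jr kr) ltrD2l ltr_pM2l //.
apply: dotv_lt_longest; last by apply: jmax; exact/asboolP.
by apply: contra kj => /eqP/a_inj ->.
Qed.

(** ** Faces *)

(** The supporting hyperplane is the sum of the inequalities that are equalities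
    at r: on the polyhedron it is attained only if all of them are. *)
Lemma sigma_face r j : cell j r -> face (cell j) (sigma r).
Proof.
move=> jr; pose dom k := `[< cell k r >].
exists (\sum_(k | dom k) (a k - a j)), (\sum_(k | dom k) (b j - b k)).
have gap x : \sum_(k | dom k) (b j - b k) - dotv (\sum_(k | dom k) (a k - a j)) x
    = \sum_(k | dom k) (aff j x - aff k x).
  rewrite dotv_suml -sumrB; apply: eq_bigr => k _.
  by rewrite dotvBl /aff; ring.
have ge0 x k : cell j x -> dom k -> 0 <= aff j x - aff k x.
  by move=> jx _; rewrite subr_ge0.
split=> [x jx|].
  by rewrite /halfspace /= -subr_ge0 gap sumr_ge0 // => k; exact: ge0.
apply/seteqP; split=> [x xs|x [jx /eqP]].
  have jx := xs j jr; split=> //=; apply/esym/eqP; rewrite -subr_eq0 gap big1 // => k.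
  by move=> /asboolP kr; rewrite (cell_eq jx (xs k kr)) subrr.
rewrite eq_sym -subr_eq0 gap => /eqP/psumr_eq0P eq0 k kr l.
have /eqP := eq0 (fun k => @ge0 x k jx) k (asboolT kr).
by rewrite subr_eq0 => /eqP <-.
Qed.

Lemma aff_combination j (k : nat) (w : 'I_k -> R) (p : 'I_k -> 'rV[R]_n) :
  \sum_i w i = 1 -> aff j (\sum_i w i *: p i) = \sum_i w i * aff j (p i).
Proof.
move=> w1; rewrite /aff dotv_sumr -[b j in LHS]mul1r -w1 big_distrl -big_split /=.
by apply: eq_bigr => i _; rewrite mulrDr.
Qed.

(** Ties at r hold on all of sigma r, hence on its affine hull, and the other
    comparisons are strict at r. *)
Lemma relint_sigma r : relint (sigma r) r.
Proof.
split=> //; apply: filterS (near_strict r) => y yU [k [p [w [ps w1 y_eq]]]] j jr l.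
have [lr|/(cell_lt jr)/yU/ltW//] := pselect (cell l r).
rewrite y_eq !aff_combination //; apply: ler_sum => i _.
by rewrite (cell_eq (ps i j jr) (ps i l lr)).
Qed.

(** Both F and sigma r allow any of their segments ending at r to be prolonged a
    little beyond r.  An affine inequality valid on the prolonged segment and tight
    at r is tight on the whole of it: this gives the ties on F, and the
    equation of F on sigma r. *)
Lemma face_sigma r j F : face (cell j) F -> relint F r -> F = sigma r.
Proof.
move=> [c [d [Fle FE]]] [Fr Fnear].
have jr : cell j r by move: Fr; rewrite FE => -[].
have dotr : dotv c r = d by move: Fr; rewrite FE => -[].
have dotv_line x s : dotv c (r + s *: (x - r)) = d + s * (dotv c x - d).
  by rewrite dotvDr dotvZr -scaleN1r dotvDr dotvZr dotr mulN1r.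
have aff_toward x s i : aff i (r + s *: (x - r)) = aff i r + s * (aff i x - aff i r).
  by rewrite aff_line -scaleN1r dotvDr dotvZr /aff; ring.
have half (e : R) : 0 < e -> `|- (e / 2)| < e.
  by move=> e0; rewrite normrN gtr0_norm ?divr_gt0 // ltr_pdivrMr // ltr_pMr // ltr1n.
apply/seteqP; split=> x.
- move=> Fx i ir; have jx : cell j x by move: Fx; rewrite FE => -[].
  have [e e0 /(_ _ (half e e0)) eF] := nbhs_line (x - r) Fnear.
  set s := - (e / 2) in eF.
  have s0 : s < 0 by rewrite oppr_lt0 divr_gt0.
  have /eF : affine_hull F (r + s *: (x - r)).
    exists 2%N, (fun l => if l == ord0 then r else x),
      (fun l => if l == ord0 then 1 - s else s).
    split; first by move=> l; case: ifP.
      by rewrite big_ord_recl big_ord1 /= subrK.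
    rewrite big_ord_recl big_ord1 /= scalerBl scale1r scalerBr.
    by rewrite addrA addrAC.
  rewrite FE => -[/(_ i) + _] k; rewrite !aff_toward (cell_eq jr ir) lerD2l ler_nM2l //.
  rewrite lerD2r => le_ji; exact: le_trans (jx k) le_ji.
- move=> xs; have jx := xs j jr; rewrite FE; split=> //=.
  have [e e0 /(_ _ (half e e0)) eU] := nbhs_line (x - r) (near_strict r).
  set s := - (e / 2) in eU.
  have s0 : s < 0 by rewrite oppr_lt0 divr_gt0.
  have /Fle : cell j (r + s *: (x - r)).
    move=> i; have [ir|/(cell_lt jr)/eU/ltW//] := pselect (cell i r).
    by rewrite !aff_toward (cell_eq jr ir) (cell_eq jx (xs i ir)).
  rewrite /halfspace /= dotv_line gerDl nmulr_rle0 // subr_ge0 => le_d.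
  by apply/le_anti; rewrite le_d andbT; exact: Fle.
Qed.

(** ** Connected components *)

Definition tie : set 'rV[R]_n :=
  [set x | exists j k, [/\ j != k, cell j x & cell k x]].

Lemma not_tie x : (0 < t)%N -> (~` tie) x <-> exists j, region j x.
Proof.
move=> t0; split=> [notie|[j jx] [k [l [kl kx lx]]]]; last first.
  by move/eqP: kl; rewrite -(region_disjoint jx kx) -(region_disjoint jx lx).
have [j jx] := exists_cell x t0; exists j => k kj.
by apply: cell_lt => // kx; apply: notie; exists k, j.
Qed.

(** The region is convex, hence connected, and it is clopen in the complement of
    the ties, which the closed polyhedron meets in the region only. *)
Lemma component_region j x : region j x -> connected_component (~` tie) x = region j.
Proof.
move=> jx; have t0 : (0 < t)%N by case: (t) j {jx} => // -[].
have sub y : region j y -> (~` tie) y by move=> jy; apply/not_tie => //; exists j.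
apply/seteqP; split=> y.
  move=> [C [Cx Csub Cconn] Cy].
  have CE : C `&` region j = C.
    apply: Cconn; first by exists x.
      by exists (region j) => //; exact: open_region.
    exists (cell j); first exact: closed_cell.
    apply/seteqP; split=> z [Cz jz]; split=> //; first exact: region_sub_cell.
    have /not_tie := Csub z Cz; move=> /(_ t0)[k kz].
    by rewrite -(region_disjoint kz jz).
  by move: Cy; rewrite -CE => -[].
move=> jy; apply: (@connected_component_max _ _ [set x + s *: (y - x) | s in `[0, 1]]).
- by exists 0; rewrite ?scale0r ?addr0 // /= in_itv /= lexx ler01.
- move=> _ [s /= + <-]; rewrite in_itv /= le_eqVlt => /andP[/orP[/eqP <-|s0] s1].
    by rewrite scale0r addr0; exact: sub.
  by apply: sub; apply: region_segment => //; exact: region_sub_cell.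
- apply: connected_continuous_connected; first exact: segment_connected.
  exact/continuous_subspaceT/line_continuous.
- by exists 1; rewrite ?scale1r ?subrKC // /= in_itv /= lexx ler01.
Qed.

End Geometry.

(** * Exponential sums *)

Section ExponentialSum.
Local Open Scope complex_scope.
Variables (R : realType) (n t : nat) (g : expsum R n t).

Definition log_weight (j : 'I_t) : R := complex.Re (offset g j).

Lemma normc_expC (z : R[i]) : `|expC z| = (expR (complex.Re z))%:C.
Proof.
rewrite /expC normrM !normc_def /= expr0n addr0 sqrtr_sqr cos2Dsin2 sqrtr1 mulr1.
by rewrite gtr0_norm ?expR_gt0.
Qed.

Lemma norm_expterm j (z : 'rV[R[i]]_n) :
  `|expterm g j z| =
  (expR (aff (freq g) log_weight j (map_mx (@complex.Re R) z)))%:C.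
Proof.
have ReD (u v : R[i]) : complex.Re (u + v) = complex.Re u + complex.Re v.
  by case: u v => [? ?] [? ?].
have Re_arg : complex.Re (\sum_i (freq g j 0 i)%:C * z 0 i + offset g j) =
    aff (freq g) log_weight j (map_mx (@complex.Re R) z).
  rewrite ReD (big_morph _ ReD (id1 := 0)) // /aff /dotv.
  rewrite (eq_bigr (fun i => freq g j 0 i * map_mx (@complex.Re R) z 0 i)) // => i _.
  by rewrite mxE; case: (z 0 i) => u v /=; rewrite mul0r subr0.
by rewrite normc_expC Re_arg.
Qed.

Lemma Trop_tie : Trop g = tie (freq g) log_weight.
Proof.
apply/seteqP; split=> x.
  move=> [z [j [k [jk jz kz]]] <-]; exists j, k; split=> // l.
    by have := jz l; rewrite !norm_expterm lecR ler_expR.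
  by have := kz l; rewrite !norm_expterm lecR ler_expR.
move=> [j [k [jk jx kx]]]; pose z := map_mx (fun u : R => u%:C) x.
have zx : map_mx (@complex.Re R) z = x by apply/rowP => i; rewrite !mxE.
exists z => //; exists j, k; split=> // l; rewrite !norm_expterm lecR ler_expR zx.
  exact: jx.
exact: kx.
Qed.

Lemma Sigma_TropP (F : set 'rV[R]_n) : (0 < t)%N -> Sigma_Trop g F <->
  exists j x, region (freq g) log_weight j x /\ face (cell (freq g) log_weight j) F.
Proof.
move=> t0; rewrite /Sigma_Trop Trop_tie; split.
  move=> [x /(not_tie _ _ _ t0)[j jx]].
  by rewrite (component_region jx) (closure_region jx) => jF; exists j, x.
move=> [j [x [jx jF]]]; exists x; first by apply/not_tie => //; exists j.
by rewrite (component_region jx) (closure_region jx).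
Qed.

Lemma sigma_unique r : (0 < t)%N ->
  unique (fun F : set 'rV[R]_n => Sigma_Trop g F /\ relint F r)
    (sigma (freq g) log_weight r).
Proof.
move=> t0; split; first split.
- have [j [x [jr jx]]] := region_near log_weight (@freq_inj _ _ _ g) r t0.
  apply/Sigma_TropP => //; exists j, x; split=> //; exact: sigma_face.
- exact: relint_sigma.
- by move=> F [/(Sigma_TropP _ t0)[j [x [_ jF]]] Fr]; rewrite (face_sigma jF Fr).
Qed.

Lemma closure_sigma (r : 'rV[R]_n) :
  closure (sigma (freq g) log_weight r) = sigma (freq g) log_weight r.
Proof.
apply/esym/closure_id => x xs j jr; apply: closed_cell => U /xs[y [ys Uy]].
by exists y; split=> //; exact: ys.
Qed.

(** ** The output describes the cell *)

Let a (k : nat) : 'rV[R]_n := oapp (freq g) 0 (insub k).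
Let b (k : nat) : R := oapp log_weight 0 (insub k).

Let aE (j : 'I_t) : a j = freq g j. Proof. by rewrite /a valK. Qed.
Let bE (j : 'I_t) : b j = log_weight j. Proof. by rewrite /b valK. Qed.

Variable r : 'rV[R]_n.
Hypothesis t_gt0 : (0 < t)%N.

Local Notation term := (aff (freq g) log_weight).
Let j0 : 'I_t := Ordinal (best_term_lt r a b t_gt0).

Let valueE (k : 'I_t) : value r a b k = term k r.
Proof. by rewrite /value aE bE. Qed.

Lemma cell_best : cell (freq g) log_weight j0 r.
Proof. by move=> k; rewrite -!valueE; exact: best_term_max. Qed.

Lemma halfspace_dominance (j k : 'I_t) s x :
  halfspace (dominance a b j k s) x <-> s * (term k x - term j x) <= 0.
Proof.
rewrite /halfspace /dominance /= dotvZl dotvBl -subr_le0 -mulrBr !aE !bE.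
rewrite /aff; set u := s * _; set v := s * _.
by have -> : u = v by rewrite /u /v; ring.
Qed.

(** The sign -1 occurs only for the terms that tie with the best one. *)
Lemma mem_output h : h \in output r a b t -> exists (k : 'I_t) (s : R),
  [/\ k != j0, h = dominance a b j0 k s &
      s = 1 \/ s = -1 /\ cell (freq g) log_weight k r].
Proof.
move=> /flattenP[_ /mapP[k' + ->]]; rewrite mem_iota /= => kt.
pose k : 'I_t := Ordinal kt; rewrite -[k']/(val k) /dominances.
case: eqP => // /eqP kj; rewrite !inE => /orP[]/eqP ->;
  exists k; eexists; split; try reflexivity.
- exact: kj.
- by left.
- exact: kj.
- rewrite -[best_term _ _ _ _]/(val j0) !valueE; case: ifP => [le_jk|_]; last by left.
  by right; split=> // l; apply: le_trans le_jk; exact: cell_best.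
Qed.

Lemma output_normal h : h \in output r a b t -> h.1 != 0.
Proof.
move=> /mem_output[k [s [kj -> s1]]];
rewrite [_.1]/(s *: (a k - a j0)) scaler_eq0 negb_or !aE subr_eq0.
have -> /= : s != 0 by case: s1 => [->|[-> _]]; rewrite ?oppr_eq0 oner_eq0.
by apply: contra kj => /eqP e; have inj := @freq_inj _ _ _ g; rewrite (inj _ _ e).
Qed.

Lemma sigma_output : sigma (freq g) log_weight r =
  [set x | forall h, h \in output r a b t -> halfspace h x].
Proof.
apply/seteqP; split=> x.
  move=> xs h /mem_output[k [s [_ -> s1]]]; apply/halfspace_dominance.
  have jx := xs j0 cell_best.
  case: s1 => [->|[-> /xs kx]]; first by rewrite mul1r subr_le0; exact: jx.
  by rewrite (cell_eq kx jx) subrr mulr0.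
move=> xhs.
have domsx (k : 'I_t) h : h \in dominances r a b j0 k -> halfspace h x.
  move=> hk; apply: xhs; apply/flattenP; exists (dominances r a b j0 k) => //.
  by apply: map_f; rewrite mem_iota /=.
have jx : cell (freq g) log_weight j0 x.
  move=> k; have [->//|kj] := eqVneq k j0.
  rewrite -subr_le0 -[leLHS]mul1r; apply/halfspace_dominance/(domsx k).
  by rewrite /dominances ifF ?mem_head //; exact: negPf kj.
move=> k kr l; apply: le_trans (jx l) _.
have [->//|kj] := eqVneq k j0.
rewrite -subr_ge0 -oppr_le0 -mulN1r; apply/halfspace_dominance/(domsx k).
rewrite /dominances ifF; last exact: negPf kj.
by rewrite ifT ?inE ?eqxx ?orbT // !valueE; exact: kr.
Qed.

(** ** The encoded input *)

Lemma nth_flatten_uniform (T : Type) (x0 : T) (ss : seq (seq T)) (m k i : nat) :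
    all (fun s => size s == m) ss -> (k < size ss)%N -> (i < m)%N ->
  nth x0 (flatten ss) (k * m + i) = nth x0 (nth [::] ss k) i.
Proof.
elim: ss k => //= s ss IH [|k] /andP[/eqP ssz ssm]; rewrite nth_cat ssz.
  by move=> _ im; rewrite mul0n im.
by move=> ks im; rewrite mulSn -addnA ltnNge leq_addr /= addKn IH.
Qed.

Lemma nth_coords (x : 'rV[R]_n) (i : 'I_n) : (coords x)`_i = x 0 i.
Proof. by rewrite (nth_map i) ?size_enum_ord // nth_ord_enum. Qed.

Lemma size_coords (x : 'rV[R]_n) : size (coords x) = n.
Proof. by rewrite size_map size_enum_ord. Qed.

Let w := encode_input r g.

Let term_cells (j : 'I_t) : seq R :=
  coords (freq g j) ++ [:: complex.Re (offset g j); complex.Im (offset g j)].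

Let terms_uniform :
  all (fun s => size s == n.+2) [seq term_cells j | j <- enum 'I_t].
Proof. by apply/allP => _ /mapP[j _ ->]; rewrite size_cat size_coords addn2. Qed.

Lemma size_encode_input : size w = (n + t * n.+2)%N.
Proof.
rewrite size_cat size_coords size_flatten /shape; congr addn.
rewrite (eq_in_map _ (fun=> n.+2) _).1.
  by rewrite -map_comp sumnE big_map big_enum sum_nat_const card_ord.
by move=> s /(allP terms_uniform)/eqP.
Qed.

Lemma nth_encode_input (k : 'I_t) i : (i < n.+2)%N ->
  w`_(n + k * n.+2 + i) = (term_cells k)`_i.
Proof.
move=> ilt; rewrite -addnA nth_cat size_coords ltnNge leq_addr /= addKn.
rewrite (nth_flatten_uniform 0 terms_uniform) //; last first.
  by rewrite size_map size_enum_ord.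
by rewrite (nth_map k) ?size_enum_ord // nth_ord_enum.
Qed.

Lemma program_outputs B : (block n t + 1 + 2 * t.-1 * n.+1 <= B)%N ->
  outputs_within (compile 0 (program R n)) w (cost (program R n)).[B]
    (encode_halfspaces (output r a b t)).
Proof.
apply: runs_program => //.
- exact: size_encode_input.
- by move=> i; rewrite nth_cat size_coords ltn_ord nth_coords.
- move=> k i kt; rewrite (@nth_encode_input (Ordinal kt)); last by have := ltn_ord i; lia.
  by rewrite nth_cat size_coords ltn_ord nth_coords -(aE (Ordinal kt)).
- move=> k kt; rewrite (@nth_encode_input (Ordinal kt)) //.
  by rewrite nth_cat size_coords ltnn subnn; exact: esym (bE (Ordinal kt)).
Qed.

End ExponentialSum.

Theorem theorem1p9 (R : realType) (n : nat) (n_ge1 : (1 <= n)%N) :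
  exists (M : machine R) (p : {poly nat}) (C : nat),
    forall (t : nat) (r : 'rV[R]_n) (g : expsum R n t), (2 <= t)%N ->
      exists (sigma : set 'rV[R]_n) (hs : seq ('rV[R]_n * R)),
        [/\ unique (fun F : set 'rV[R]_n => Sigma_Trop g F /\ relint F r) sigma,
            outputs_within M (encode_input r g) p.[input_size n t]
              (encode_halfspaces hs),
            (size hs <= C * t ^ 2)%N,
            forall h, h \in hs -> h.1 != 0 &
            closure sigma = [set x | forall h, h \in hs -> halfspace h x]].
Proof.
exists (compile 0 (program R n)).
(* The memory grows to at most 4S+2 cells for an input of size S, and this also
   bounds the number t of terms; both loops and all memory accesses stay within. *)
exists (cost (program R n) \Po (4%:P * 'X + 2%:P)), 2 => t r g t_ge2.
have t_gt0 : (0 < t)%N by exact: ltnW.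
exists (sigma (freq g) (log_weight g) r).
exists (output r (fun k => oapp (freq g) 0 (insub k))
  (fun k => oapp (log_weight g) 0 (insub k)) t).
split.
- exact: sigma_unique.
- have -> : (cost (program R n) \Po (4%:P * 'X + 2%:P)).[input_size n t] =
      (cost (program R n)).[(4 * input_size n t + 2)%N].
    rewrite horner_comp; congr (_.[_]).
    by rewrite hornerD hornerM hornerX !hornerC.
  apply: program_outputs => //; rewrite /block /input_size; nia.
- rewrite size_output // leq_mul2l /=; apply: leq_trans (leq_pred t) _.
  by rewrite expnS leq_pmulr // expn_gt0 t_gt0.
- move=> h; exact: output_normal.
- by rewrite closure_sigma (sigma_output g r t_gt0).
Qed.
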